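(* Let $(G,+,0)$ be a finite cyclic group of order $n\in\mathbb{N}$ and let $M$ be a subset of $\mathbb{N}$. If $|M|=k$, $\{k-3,k-2,k-1,k\}\subseteq M$ and $\mathrm{lcm}(k-3,k-2,k-1,k)\mid n$, then $M$ does not completely split $G$.
   Context: $\mathbb{N}$ is the set of positive integers. For a set of integers $M$ and a finite abelian group $G$ (written additively), $M$ completely splits $G$ if there is a subset $S\subseteq G$ such that every element of $G$ (including $0$) has a unique representation $ms$ with $m\in M$, $s\in S$. *)

(* Defs.v *)
From mathcomp Require Import all_boot all_order all_algebra all_fingroup all_solvable.
From mathcomp Require Import classical_sets functions cardinality.

Set Implicit Arguments.
Unset Strict Implicit.
Unset Printing Implicit Defensive.

Import Order.TTheory GRing.Theory Num.Theory.
Local Open Scope ring_scope.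

(* Uniqueness is that of the pair (m, s), not merely of the value of m or s. *)
Definition completely_splits (M : set int) (G : finZmodType) : Prop :=
  exists S : {set G}, forall g : G,
    exists! p : int * G, [/\ M p.1, p.2 \in S & p.2 *~ p.1 = g].

(* Main.v *)
(** With dG for the set of multiples of d in G, disjointness of the dilates mS
    and |S| = |G|/k force kS = kG by counting, then (k-1)S = (k-1)G \ kG.  Hence
    every other mS avoids kG and (k-1)G.  If k is even, (k-2)G \ (kG u (k-1)G)
    has fewer than |G|/k elements, so it cannot contain (k-2)S.  If k is odd, it
    has exactly |G|/k elements, so it equals (k-2)S; then (k-3)S must avoid
    (k-1)G and (k-2)G as well, and since k-3 is even the same count fails. *)
Require Import Defs.
From mathcomp Require Import all_boot all_order all_algebra all_fingroup all_solvable.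
From mathcomp Require Import classical_sets functions cardinality.
From mathcomp Require Import zify.

Set Implicit Arguments.
Unset Strict Implicit.
Unset Printing Implicit Defensive.

Import Order.TTheory GRing.Theory Num.Theory.
Local Open Scope ring_scope.

Definition multiples (G : finZmodType) (d : nat) : {set G} :=
  [set x *+ d | x in [set: G]%SET]%SET.

Lemma lcmn_coprime (a b : nat) : coprime a b -> lcmn a b = (a * b)%N.
Proof. by move=> /eqP co; rewrite -muln_lcm_gcd co muln1. Qed.

Section CyclicMultiples.

Variable G : finZmodType.
Hypothesis cyclicG : cyclic [set: G]%SET.
Local Notation n := #|G|.

(** As [d] divides the order [n] of [x], divisibility of an exponent by [d] is unchanged modulo [n],
    so any exponent representing the element decides membership. *)
Lemma multiplesP (x : G) (i d : nat) :
  [set: G]%SET = <[x]>%g -> (d %| n)%N ->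
  (x *+ i \in multiples G d) = (d %| i)%N.
Proof.
move=> Gx dn; have ox : #[x]%g = n by rewrite orderE -Gx cardsT.
apply/imsetP/idP => [[y _]|/dvdnP[q ->]]; last first.
  by exists (x *+ q); rewrite ?inE // mulrnA.
have /cycleP[q ->] : y \in <[x]>%g by rewrite -Gx inE.
rewrite FinRing.zmodXgE -mulrnA -!FinRing.zmodXgE => /eqP.
rewrite eq_expg_mod_order ox => /eqP Eiq.
by rewrite /dvdn -(modn_dvdm i dn) Eiq modn_dvdm // modnMl.
Qed.

Lemma card_multiples (d : nat) : (d %| n)%N -> #|multiples G d| = (n %/ d)%N.
Proof.
move=> dn; have /cyclicP[x Gx] := cyclicG.
have ox : #[x]%g = n by rewrite orderE -Gx cardsT.
have -> : multiples G d = <[x ^+ d]>%g.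
  apply/setP=> y; have /cycleP[i ->] : y \in <[x]>%g by rewrite -Gx inE.
  rewrite {1}FinRing.zmodXgE multiplesP //.
  apply/idP/cycleP => [/dvdnP[q ->]|[q]].
    by exists q; rewrite -expgM mulnC.
  rewrite -expgM => /eqP; rewrite eq_expg_mod_order ox => /eqP E.
  by rewrite /dvdn -(modn_dvdm i dn) E modn_dvdm // modnMr.
by rewrite -orderE orderXdiv ox.
Qed.

Lemma multiplesI (a b : nat) : (a %| n)%N -> (b %| n)%N ->
  (multiples G a :&: multiples G b)%SET = multiples G (lcmn a b).
Proof.
move=> an bn; have /cyclicP[x Gx] := cyclicG.
apply/setP=> y; have /cycleP[i ->] : y \in <[x]>%g by rewrite -Gx inE.
by rewrite FinRing.zmodXgE inE !multiplesP ?dvdn_lcm ?an.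
Qed.

(** Inclusion-exclusion, with intersections given by lcms; the negative terms are moved to the left
    to avoid truncated subtraction. *)
Lemma card_multiplesD (a b c : nat) :
  (a %| n)%N -> (b %| n)%N -> (c %| n)%N ->
  (#|multiples G a :\: (multiples G b :|: multiples G c)|
     + n %/ lcmn a b + n %/ lcmn a c
   = n %/ a + n %/ lcmn (lcmn a b) (lcmn a c))%N.
Proof.
move=> an bn cn.
have H := cardsID (multiples G b :|: multiples G c) (multiples G a).
have K := cardsUI (multiples G a :&: multiples G b)
                  (multiples G a :&: multiples G c).
rewrite !finset.setIUr !multiplesI ?dvdn_lcm ?an ?bn ?cn // in H K.
rewrite !card_multiples ?dvdn_lcm ?an ?bn ?cn // in H K.
by rewrite -H -addnA -K addnCA addnA.
Qed.

(** For even [j] the numbers [j] and [j.+2] have gcd 2, which doubles two terms of the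
    inclusion-exclusion. The count nj/((j+1)(j+2)) is below n/(j+3), because j(j+3) < (j+1)(j+2). *)
Lemma card_multiplesD_even (j : nat) : (0 < j)%N -> ~~ odd j ->
  (j %| n -> j.+1 %| n -> j.+2 %| n ->
   #|multiples G j :\: (multiples G j.+1 :|: multiples G j.+2)|
     * (j.+1 * j.+2) = n * j)%N.
Proof.
move=> j0 /even_halfK Ej; rewrite -{}Ej in j0 *; move: j0.
set i := j./2; rewrite double_gt0 => i0 an bn cn.
have E1 : lcmn i.*2 i.*2.+1 = (i.*2 * i.*2.+1)%N.
  by rewrite lcmn_coprime // coprimenS.
have E2 : lcmn i.*2 i.*2.+2 = (i.*2 * i.+1)%N.
  by rewrite -doubleS -!mul2n -muln_lcmr lcmn_coprime ?coprimenS // mulnA.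
have E3 : lcmn (lcmn i.*2 i.*2.+1) (lcmn i.*2 i.*2.+2)
          = (i.*2 * (i.*2.+1 * i.+1))%N.
  rewrite E1 E2 -muln_lcmr lcmn_coprime //.
  (* [i.+1] is a factor of [i.*2.+2], the successor of [i.*2.+1]. *)
  have := coprimenS i.*2.+1.
  by rewrite -doubleS -(mul2n i.+1) coprimeMr => /andP[].
have := card_multiplesD an bn cn.
have : (lcmn (lcmn i.*2 i.*2.+1) (lcmn i.*2 i.*2.+2) %| n)%N.
  by rewrite !dvdn_lcm an bn cn.
(* Writing [n] as [t] times the overall lcm makes every quotient an explicit polynomial. *)
rewrite E3 E1 E2 => /dvdnP[t ->] {an bn cn E1 E2 E3}.
have -> : (t * (i.*2 * (i.*2.+1 * i.+1)) %/ (i.*2 * i.*2.+1) = t * i.+1)%N.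
  by rewrite (_ : _ * _ = t * i.+1 * (i.*2 * i.*2.+1))%N ?mulnK //; lia.
have -> : (t * (i.*2 * (i.*2.+1 * i.+1)) %/ (i.*2 * i.+1) = t * i.*2.+1)%N.
  by rewrite (_ : _ * _ = t * i.*2.+1 * (i.*2 * i.+1))%N ?mulnK //; lia.
have -> : (t * (i.*2 * (i.*2.+1 * i.+1)) %/ i.*2 = t * (i.*2.+1 * i.+1))%N.
  by rewrite (_ : _ * _ = t * (i.*2.+1 * i.+1) * i.*2)%N ?mulnK //; lia.
rewrite mulnK; last by lia.
move=> E; have -> : #|multiples G i.*2 :\:
  (multiples G i.*2.+1 :|: multiples G i.*2.+2)| = (t * (2 * i * i))%N by lia.
lia.
Qed.

(** For odd [j] all three lcms are plain products, and inclusion-exclusion gives n((j+1)(j+2) -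
    (j+2) - (j+1) + 1)/(j(j+1)(j+2)) = n/(j+2). *)
Lemma card_multiplesD_odd (j : nat) : odd j ->
  (j %| n -> j.+1 %| n -> j.+2 %| n ->
   #|multiples G j :\: (multiples G j.+1 :|: multiples G j.+2)| * j.+2 = n)%N.
Proof.
move=> oj an bn cn; have j0 := odd_gt0 oj.
have E1 : lcmn j j.+1 = (j * j.+1)%N by rewrite lcmn_coprime ?coprimenS.
have E2 : lcmn j j.+2 = (j * j.+2)%N.
  by rewrite lcmn_coprime // -addn2 /coprime gcdnDl -/(coprime _ _) coprimen2.
have E3 : lcmn (lcmn j j.+1) (lcmn j j.+2) = (j * (j.+1 * j.+2))%N.
  by rewrite E1 E2 -muln_lcmr lcmn_coprime // coprimenS.
have := card_multiplesD an bn cn.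
have : (lcmn (lcmn j j.+1) (lcmn j j.+2) %| n)%N.
  by rewrite !dvdn_lcm an bn cn.
rewrite E3 E1 E2 => /dvdnP[t ->] {an bn cn E1 E2 E3}.
have -> : (t * (j * (j.+1 * j.+2)) %/ (j * j.+1) = t * j.+2)%N.
  by rewrite (_ : _ * _ = t * j.+2 * (j * j.+1))%N ?mulnK //; lia.
have -> : (t * (j * (j.+1 * j.+2)) %/ (j * j.+2) = t * j.+1)%N.
  by rewrite (_ : _ * _ = t * j.+1 * (j * j.+2))%N ?mulnK //; lia.
have -> : (t * (j * (j.+1 * j.+2)) %/ j = t * (j.+1 * j.+2))%N.
  by rewrite (_ : _ * _ = t * (j.+1 * j.+2) * j)%N ?mulnK //; lia.
rewrite mulnK; last by lia.
move=> E; have -> : #|multiples G j :\: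
  (multiples G j.+1 :|: multiples G j.+2)| = (t * (j * j.+1))%N by lia.
lia.
Qed.

(** Here [j] is k-3. Of the whole splitting only two consequences are kept: the bound n <= |S|k, and
    the injectivity and disjointness of the last four dilates. *)
Lemma four_dilates_not_disjoint (S : {set G}) (j : nat) :
  (0 < j)%N -> (n <= #|S| * j.+3)%N ->
  (forall m, j <= m <= j.+3 -> m %| n)%N ->
  (forall (a b : nat) (s t : G), (j <= a <= j.+3)%N -> (j <= b <= j.+3)%N ->
     s \in S -> t \in S -> s *+ a = t *+ b -> a = b /\ s = t) -> False.
Proof.
move=> j0 nS dvd inj.
have n0 : (0 < n)%N by apply/card_gt0P; exists 0.
pose T m : {set G} := [set s *+ m | s in S]%SET.
have Tmult m x : x \in T m -> x \in multiples G m.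
  by move=> /imsetP[s _ ->]; apply/imsetP; exists s; rewrite ?inE.
have cardT m : (j <= m <= j.+3)%N -> #|T m| = #|S|.
  by move=> jm; apply: card_in_imset => s t Ss St /(inj _ _ _ _ jm jm Ss St)[].
have Tdisj a b x : (j <= a <= j.+3)%N -> (j <= b <= j.+3)%N -> a <> b ->
    x \in T a -> x \notin T b.
  move=> ja jb ab /imsetP[s Ss ->]; apply/negP => /imsetP[t St].
  by move=> /(inj _ _ _ _ ja jb Ss St)[].
(* One inclusion is clear, and |kG| = n/k is at most |S|. *)
have T3 : T j.+3 = multiples G j.+3.
  apply/eqP; rewrite eqEcard cardT ?card_multiples ?dvd; try lia.
  rewrite leq_divLR ?dvd ?nS ?andbT; try lia.
  by apply/fintype.subsetP => x /Tmult.
have T2 : T j.+2 = multiples G j.+2 :\: multiples G j.+3.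
  apply/eqP; rewrite eqEcard cardT; last lia.
  apply/andP; split.
    apply/fintype.subsetP => x Tx; rewrite inE (Tmult _ _ Tx) andbT -T3.
    by apply: (Tdisj j.+2) Tx; lia.
  rewrite cardsD multiplesI ?card_multiples ?dvdn_lcm ?dvd; try lia.
  (* With n = t(k-1)k, the difference has tk - t = t(k-1) = n/k elements, again at most |S|. *)
  have : (lcmn j.+2 j.+3 %| n)%N by rewrite dvdn_lcm !dvd //; lia.
  rewrite lcmn_coprime ?coprimenS // => /dvdnP[t Et].
  rewrite Et mulnK // (mulnC j.+2) mulnA mulnK //.
  by rewrite -(leq_pmul2r (isT : 0 < j.+3)%N); lia.
have cover2 x : x \in multiples G j.+2 -> x \in T j.+2 \/ x \in T j.+3.
  by move=> xm; rewrite T2 T3 inE xm andbT; case: (x \in _); [right|left].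
have avoid m x : (j <= m < j.+2)%N -> x \in T m ->
    x \notin multiples G j.+2 /\ x \notin multiples G j.+3.
  move=> jm Tx; split; apply/negP.
    by move=> /cover2[]; apply/negP; apply: (Tdisj m) Tx; lia.
  by rewrite -T3; apply/negP; apply: (Tdisj m) Tx; lia.
(* The even count, for [i] equal to [j] or [j.+1], serves both parities of k. From n <= |S|(j+3) <=
   |X|(i+3) it would follow that (i+1)(i+2) <= i(i+3), which is off by 2. *)
have small i : (0 < i)%N -> ~~ odd i -> (j <= i)%N -> (i.+2 <= j.+3)%N ->
    (T i \subset multiples G i :\: (multiples G i.+1 :|: multiples G i.+2)) ->
    False.
  move=> i0 ei ji ij /subset_leq_card.
  rewrite cardT; last lia.
  have := card_multiplesD_even i0 ei; rewrite !dvd; try lia.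
  move=> /(_ isT isT isT); set X := #|_|%N => EX SX.
  have : (n * (i.+1 * i.+2) <= n * (i * i.+3))%N.
    apply: (@leq_trans (X * i.+3 * (i.+1 * i.+2))%N).
      rewrite leq_mul2r; apply/orP; right.
      by apply: (leq_trans nS); rewrite leq_mul //; lia.
    by rewrite mulnAC EX mulnA.
  by rewrite leq_pmul2l //; lia.
have sub1 : T j.+1 \subset
    multiples G j.+1 :\: (multiples G j.+2 :|: multiples G j.+3).
  apply/fintype.subsetP => x Tx; rewrite !inE (Tmult _ _ Tx) andbT.
  by have [] := avoid j.+1 x; [lia| |move=> /negbTE-> /negbTE->].
(* If [j] is odd, then k-2 = [j.+1] is even and already too sparse. *)
case oj : (odd j); first by apply: (small j.+1) => //=; rewrite ?oj.
have T1 : T j.+1 = multiples G j.+1 :\: (multiples G j.+2 :|: multiples G j.+3).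
  apply/eqP; rewrite eqEcard sub1 cardT; last lia.
  have := @card_multiplesD_odd j.+1; rewrite /= oj !dvd; try lia.
  by move=> /(_ isT isT isT isT) E; rewrite -(leq_pmul2r (isT : 0 < j.+3)%N) E.
apply: (small j) => //; rewrite ?oj //.
apply/fintype.subsetP => x Tx; rewrite !inE (Tmult _ _ Tx) andbT.
have [|//|/negbTE n2 /negbTE n3] := avoid j x; first lia.
rewrite n2 orbF; apply/negP => x1.
have : x \in T j.+1 by rewrite T1 !inE x1 n2 n3.
by apply/negP; apply: (Tdisj j) Tx; lia.
Qed.

End CyclicMultiples.

Theorem proposition8 (G : finZmodType) (n : nat) (M : set int) (k : nat)
  (cyclicG : cyclic [set: G]%SET)
  (cardG : #|G| = n)
  (Mpos : forall m : int, M m -> 0 < m)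
  (cardM : (M #= `I_k)%card)
  (Mk3 : M (k%:Z - 3)) (Mk2 : M (k%:Z - 2)) (Mk1 : M (k%:Z - 1)) (Mk : M k%:Z)
  (lcm_dvd_n :
    (lcmz (lcmz (lcmz (k%:Z - 3) (k%:Z - 2)) (k%:Z - 1)) k%:Z %| n%:Z)%Z) :
  ~ completely_splits M G.
Proof.
case=> S splitS.
have k3 := Mpos _ Mk3.
(* Positivity of k-3 excludes k < 3; substituting k = j+3 then turns integer differences into
   successors. *)
case: k => [|[|[|j]]] in cardM Mk3 Mk2 Mk1 Mk lcm_dvd_n k3 *; try by [].
have Ek3 : j.+3%:Z - 3 = j%:Z by lia.
have Ek2 : j.+3%:Z - 2 = j.+1%:Z by lia.
have Ek1 : j.+3%:Z - 1 = j.+2%:Z by lia.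
rewrite {}Ek3 {}Ek2 {}Ek1 in Mk3 Mk2 Mk1 lcm_dvd_n k3.
have range m : (j <= m <= j.+3)%N -> [\/ m = j, m = j.+1, m = j.+2 | m = j.+3].
  move=> jm; have : m = j \/ m = j.+1 \/ m = j.+2 \/ m = j.+3 by lia.
  by case=> [->|[->|[->|->]]]; constructor.
have Mrange m : (j <= m <= j.+3)%N -> M m%:Z by move=> /range[] ->.
apply: (@four_dilates_not_disjoint G cyclicG S j).
- by lia.
- move: cardM => /card_set_bijP[f [fI finj fsurj]].
  (* A chosen inverse [h] of the bijection enumerates [M] by k indices, so [G] is an image of the
     product of [S] and ['I_j.+3], whence n <= |S|k. *)
  have /boolp.choice[h hP] : forall i : 'I_j.+3, exists m, M m /\ f m = i.
    by move=> i; have [m Mm fm] := fsurj i (ltn_ord i); exists m.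
  pose F (p : G * 'I_j.+3) := p.1 *~ h p.2.
  have cover : [set: G]%SET \subset
      [set F p | p in finset.setX S [set: 'I_j.+3]]%SET.
    apply/fintype.subsetP => g _.
    have [[m s] [[/= Mm Ss <-] _]] := splitS g.
    pose i : 'I_j.+3 := Ordinal (fI _ Mm); have [Mi fi] := hP i.
    have <- : h i = m by apply: finj fi; apply: mem_set.
    by apply/imsetP; exists (s, i); rewrite ?inE /= ?Ss.
  rewrite -cardsT; apply: leq_trans (subset_leq_card cover) _.
  by apply: leq_trans (leq_imset_card _ _) _; rewrite cardsX cardsT card_ord.
- rewrite cardG => m /range; move: lcm_dvd_n; rewrite !dvdz_lcm /= -!andbA.
  by move=> /and4P[d0 d1 d2 d3] [] ->.
- move=> a b s t /Mrange Ma /Mrange Mb Ss St E.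
  (* Both (a, s) and (b, t) represent this element, so each equals its unique representation [p]. *)
  have [p [_ up]] := splitS (s *+ a).
  have := up (a%:Z, s) (And3 Ma Ss erefl).
  by rewrite (up (b%:Z, t) (And3 Mb St (esym E))) => -[-> ->].
Qed.
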